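(* Let $n\ge 0$ and let $\Gamma$ be a quiver whose underlying undirected graph is the extended Dynkin diagram $\widetilde{A_n}$. Then there exists an infinite-dimensional transitive Hilbert representation of $\Gamma$ if and only if $\Gamma$ is not an oriented cyclic quiver.
   Context: A quiver $\Gamma=(V,E,s,r)$ consists of a finite set $V$ of vertices, a finite set $E$ of arrows and maps $s,r:E\to V$ (an arrow $\alpha$ goes from $s(\alpha)$ to $r(\alpha)$); loops and multiple arrows are allowed. The underlying undirected graph is obtained by forgetting the directions of the arrows. The diagram $\widetilde{A_n}$ is the cycle with $n+1$ vertices and $n+1$ edges ($\widetilde{A_0}$ is one vertex with one loop, $\widetilde{A_1}$ is two vertices joined by two edges). An oriented cyclic quiver is a quiver $C_m$ ($m\ge 1$) with vertices $1,\dots,m$ and arrows $\alpha_1,\dots,\alpha_m$ with $\alpha_i:i\to i+1$ for $1\le i\le m-1$ and $\alpha_m:m\to 1$ ($C_1$ is one vertex with one loop). A Hilbert representation $(H,f)$ of $\Gamma$ is a family $H=(H_v)_{v\in V}$ of complex Hilbert spaces together with a family $f=(f_\alpha)_{\alpha\in E}$ of bounded linear operators $f_\alpha:H_{s(\alpha)}\to H_{r(\alpha)}$. $End(H,f)$ is the algebra of all families $T=(T_v)_{v\in V}$ of bounded operators $T_v\in B(H_v)$ with $T_{r(\alpha)}f_\alpha=f_\alpha T_{s(\alpha)}$ for all $\alpha\in E$; $I=(I_{H_v})_{v\in V}$. A non-zero Hilbert representation (some $H_v\neq 0$) is called transitive if $End(H,f)=\mathbb{C}I$. $(H,f)$ is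 infinite-dimensional if $H_v$ is infinite-dimensional for some $v\in V$. *)

(* Defs.v *)
From HB Require Import structures.
From mathcomp Require Import all_boot all_order all_algebra.
From mathcomp Require Import all_classical all_reals all_analysis.
From mathcomp Require Import complex.

Set Implicit Arguments.
Unset Strict Implicit.
Unset Printing Implicit Defensive.

Import Order.TTheory GRing.Theory Num.Theory.
Import numFieldNormedType.Exports.

Local Open Scope classical_set_scope.
Local Open Scope ring_scope.
Local Open Scope complex_scope.

Record quiver := Quiver {
  vertex : finType;
  arrow : finType;
  source : arrow -> vertex;
  target : arrow -> vertex
}.

Definition quiver_iso (G G' : quiver) : Prop :=
  exists (phi : vertex G -> vertex G') (psi : arrow G -> arrow G'),
    [/\ bijective phi, bijective psi &
        forall a, source (psi a) = phi (source a) /\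
                  target (psi a) = phi (target a)].

(* Undirected multigraphs: [ends e] is the set of endpoints of [e], a
   singleton exactly when [e] is a loop. *)
Record multigraph := Multigraph {
  node : finType;
  edge : finType;
  ends : edge -> {set node}
}.

Definition multigraph_iso (D D' : multigraph) : Prop :=
  exists (phi : node D -> node D') (psi : edge D -> edge D'),
    [/\ bijective phi, bijective psi &
        forall e, ends (psi e) = (phi @: ends e)%SET].

Definition underlying (G : quiver) : multigraph :=
  @Multigraph (vertex G) (arrow G) (fun a => [set source a; target a]%SET).

(* [ordS i] is the cyclic successor i + 1 mod (n + 1) in ['I_n.+1]: this is a
   loop for n = 0 and a pair of parallel edges for n = 1. *)
Definition Atilde (n : nat) : multigraph :=
  @Multigraph 'I_n.+1 'I_n.+1 (fun i => [set i; ordS i]%SET).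

Definition oriented_cycle (m : nat) : quiver :=
  @Quiver 'I_m 'I_m id (@ordS m).

Definition oriented_cyclic (G : quiver) : Prop :=
  exists m : nat, (1 <= m)%N /\ quiver_iso G (oriented_cycle m).

(* The norm of a normed module over [R[i]] takes its values in [R[i]] (they
   are nonnegative reals), as does the inner product. *)
HB.mixin Record CompleteNormedModule_isHilbert (R : realType) H
    & CompleteNormedModule R[i] H := {
  inner : {dot H for @Num.conj R[i]} ;
  sqr_normE : forall x : H, `|x| ^+ 2 = inner x x
}.

#[short(type="hilbertType")]
HB.structure Definition Hilbert (R : realType) :=
  {H of CompleteNormedModule_isHilbert R H & CompleteNormedModule R[i] H}.

Record bounded_operator (R : realType) (H K : hilbertType R) :=
  BoundedOperator {
    operator_fun :> {linear H -> K};
    operator_bounded :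
      exists M : R, forall x : H, `|operator_fun x| <= M%:C * `|x|
  }.

Definition finite_dimensional (R : realType) (H : hilbertType R) : Prop :=
  exists (d : nat) (b : 'I_d -> H),
    forall x : H, exists c : 'I_d -> R[i], x = \sum_(i < d) c i *: b i.

Record hilbert_rep (R : realType) (G : quiver) := HilbertRep {
  space : vertex G -> hilbertType R;
  arrow_map : forall a : arrow G,
    bounded_operator (space (source a)) (space (target a))
}.

Section HilbertRepresentations.
Variables (R : realType) (G : quiver) (M : hilbert_rep R G).

Definition operator_family : Type :=
  forall v : vertex G, bounded_operator (space M v) (space M v).

Definition endomorphisms : set operator_family :=
  [set T | forall (a : arrow G) (x : space M (source a)),
             T (target a) (arrow_map M a x) = arrow_map M a (T (source a) x)].

Definition scalar_families : set operator_family :=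
  [set T | exists c : R[i], forall (v : vertex G) (x : space M v),
             T v x = c *: x].

Definition nonzero_rep : Prop :=
  exists (v : vertex G) (x : space M v), x != 0.

Definition transitive_rep : Prop := nonzero_rep /\ endomorphisms = scalar_families.

Definition infinite_dimensional_rep : Prop :=
  exists v : vertex G, ~ finite_dimensional (space M v).

End HilbertRepresentations.

(* Main.v *)
Require Import Defs.
From HB Require Import structures.
From mathcomp Require Import all_boot all_order all_algebra.
From mathcomp Require Import all_classical all_reals all_analysis.
From mathcomp Require Import complex.
From mathcomp Require Import ring lra zify.

(** Let Γ be a quiver on the cycle with n + 1 vertices.

Oriented cycles. Let F_w : H_(p w) -> H_w be the operator of the unique arrow
entering w, and let N push a family d = (d_v) of vectors one step along the
arrows: (N d)_w = F_w (d_(p w)). Going once around the cycle is an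
endomorphism of the representation, so if the representation is transitive
then N^m is a scalar, m being the length of the cycle. Let k < m be the
largest exponent with N^k <> 0. Then N^(k+1) = mu for some scalar mu: it is
N^m if k + 1 = m and 0 otherwise. For every rank-one map X on families,
  T = sum_(j <= k) N^j X N^(k-j)
commutes with N, because N T - T N telescopes to N^(k+1) X - X N^(k+1) = 0. Its
diagonal blocks form an endomorphism of finite rank, and X can be chosen so
that this endomorphism is not zero. Being a scalar, it is invertible, and
every H_v is finite-dimensional ([cyclic_system_finite_dimensional]).

Other orientations. If no vertex had two outgoing arrows, every vertex would
have exactly one and Γ would be an oriented cycle. So two distinct arrows a and
b leave the same vertex v0. Put the sequence space l^2 at every vertex, the
diagonal operator A = diag(1/(k+1)) on a, the unilateral shift B on b and the
identity on every other arrow. The vertices other than v0 are joined to each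
other by identities, so an endomorphism is a pair (T1, T2), T1 acting at v0
and T2 elsewhere, with T2 A = A T1 and T2 B = B T1. On matrix entries these
equations say that T2 (i+1, j+1) = (i+1)/(j+1) T2 (i, j). Below the diagonal
the entries of T2 thus grow without bound along each diagonal, unless they
vanish, and those above it are zero because row 0 of B is. Since T2 is bounded,
only scalars remain ([kronecker_scalar]).

The space l^2 over the complex numbers is built first, as a complete space
whose norm comes from an inner product. *)

Set Implicit Arguments.
Unset Strict Implicit.
Unset Printing Implicit Defensive.

Import Order.TTheory GRing.Theory Num.Theory.
Import numFieldNormedType.Exports.

Local Open Scope classical_set_scope.
Local Open Scope ring_scope.
Local Open Scope complex_scope.

Local Notation Re := complex.Re.
Local Notation Im := complex.Im.

(** * Squared moduli, complex series and square summable sequences *)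

Section SquareModulus.
Variable R : realType.
Implicit Types a b z : R[i].

(** The squared modulus as an element of [R], where series and suprema are
available; [`|z| ^+ 2] is its image in [R[i]]. *)
Definition sqmod z : R := Re z ^+ 2 + Im z ^+ 2.

Lemma sqmod_ge0 z : 0 <= sqmod z.
Proof. by rewrite addr_ge0 ?sqr_ge0. Qed.

Lemma sqmodE z : (sqmod z)%:C = `|z| ^+ 2.
Proof. exact: add_Re2_Im2. Qed.

Lemma mul_conjc z : z * z^*%C = (sqmod z)%:C.
Proof. by rewrite sqmodE sqr_normc. Qed.

Lemma sqmod_eq0 z : (sqmod z == 0) = (z == 0).
Proof.
by rewrite -(inj_eq (@complexI R)) sqmodE expf_eq0 /= normr_eq0.
Qed.

Lemma sqmodM a b : sqmod (a * b) = sqmod a * sqmod b.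
Proof. by apply: complexI; rewrite rmorphM /= !sqmodE normrM exprMn. Qed.

Lemma sqmodD_le a b : sqmod (a + b) <= 2 * (sqmod a + sqmod b).
Proof.
case: a b => [x y] [x' y'].
have := (sqr_ge0 (x - x'), sqr_ge0 (y - y')).
by move=> [? ?]; rewrite /sqmod /=; nra.
Qed.

Lemma Re_mul_conj_le a b : `|Re (a * b^*%C)| <= sqmod a + sqmod b.
Proof. case: a b => [x y] [x' y'].
have := (sqr_ge0 (x - x'), sqr_ge0 (x + x'), sqr_ge0 (y - y'), sqr_ge0 (y + y')).
by move=> [[[? ?] ?] ?]; rewrite /sqmod /= ler_norml; apply/andP; split; nra.
Qed.

Lemma Im_mul_conj_le a b : `|Im (a * b^*%C)| <= sqmod a + sqmod b.
Proof. case: a b => [x y] [x' y'].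
have := (sqr_ge0 (y - x'), sqr_ge0 (y + x'), sqr_ge0 (x - y'), sqr_ge0 (x + y')).
by move=> [[[? ?] ?] ?]; rewrite /sqmod /= ler_norml; apply/andP; split; nra.
Qed.

Lemma Re_axpy a b z : Re (a * b + z) = Re a * Re b - Im a * Im b + Re z.
Proof. by case: a b z => [? ?] [? ?] [? ?]. Qed.

Lemma Im_axpy a b z : Im (a * b + z) = Re a * Im b + Im a * Re b + Im z.
Proof. by case: a b z => [? ?] [? ?] [? ?]. Qed.

End SquareModulus.

Section ComplexSeries.
Variable R : realType.
Implicit Types f g : nat -> R[i].

(** Complex series are summed componentwise, to rely on the convergence theory
of real series. *)
Definition csummable f : Prop :=
  cvgn (series (fun k => Re (f k))) /\ cvgn (series (fun k => Im (f k))).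

Definition csum f : R[i] :=
  limn (series (fun k => Re (f k))) +i* limn (series (fun k => Im (f k))).

Lemma csum_linear (a : R[i]) f g : csummable f -> csummable g ->
  csum (fun k => a * f k + g k) = a * csum f + csum g.
Proof.
move=> [fr fi] [gr gi]; rewrite /csum.
have -> : (fun k => Re (a * f k + g k)) =
    Re a *: (fun k => Re (f k)) - Im a *: (fun k => Im (f k))
    + (fun k => Re (g k)) :> (nat -> R).
  by apply/funext => k; exact: Re_axpy.
have -> : (fun k => Im (a * f k + g k)) =
    Re a *: (fun k => Im (f k)) + Im a *: (fun k => Re (f k))
    + (fun k => Im (g k)) :> (nat -> R).
  by apply/funext => k; exact: Im_axpy.
have cZ c (h : nat -> R) : cvgn (series h) -> cvgn (series (c *: h)).
  exact: is_cvg_seriesZ.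
rewrite lim_seriesD//; last by apply: is_cvg_seriesB; apply: cZ.
rewrite lim_seriesB; [|exact: cZ..].
rewrite lim_seriesD//; last by apply: is_cvg_seriesD; apply: cZ.
rewrite lim_seriesD; [|exact: cZ..].
rewrite !lim_seriesZ//; apply/eqP; rewrite eq_complex Re_axpy Im_axpy.
by apply/andP; split; apply/eqP; reflexivity.
Qed.

Lemma csum_conj f : csummable f -> csum (fun k => (f k)^*%C) = (csum f)^*%C.
Proof.
move=> [fr fi]; rewrite /csum /=; congr (_ +i* _).
  by congr (limn (series _)); apply/funext => k; case: (f k).
rewrite -lim_seriesN //; congr (limn (series _)).
by apply/funext => k; rewrite fctE; case: (f k).
Qed.

End ComplexSeries.

Section SquareSummable.
Variable R : realType.
Implicit Types u v : nat -> R[i].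

Definition square_summable u : Prop :=
  exists M : R, forall n, \sum_(0 <= k < n) sqmod (u k) <= M.

Definition ell2_pred : {pred nat -> R[i]} := fun u => `[< square_summable u >].

Lemma ell2_submod_closed : submod_closed ell2_pred.
Proof.
split.
  apply/asboolP; exists 0 => n; rewrite big1 // => k _.
  by rewrite /sqmod /= expr0n addr0.
move=> a u v /asboolP[M Mu] /asboolP[N Nv]; apply/asboolP.
exists (2 * (sqmod a * M + N)) => n.
have H : \sum_(0 <= k < n) sqmod ((a *: u + v) k) <=
   \sum_(0 <= k < n) 2 * (sqmod a * sqmod (u k) + sqmod (v k)).
  by apply: ler_sum => k _; rewrite -sqmodM; exact: sqmodD_le.
apply: le_trans H _; rewrite -mulr_sumr big_split /= -mulr_sumr.
by rewrite ler_pM2l // lerD // ler_wpM2l ?sqmod_ge0.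
Qed.

HB.instance Definition _ :=
  GRing.isSubmodClosed.Build R[i] (nat -> R[i]) ell2_pred
    (GRing.submod_closed_semi ell2_submod_closed).

Record ell2 := Ell2 { ell2_val :> nat -> R[i]; ell2_valP : ell2_val \in ell2_pred }.

HB.instance Definition _ := [isSub for ell2_val].
HB.instance Definition _ := [Choice of ell2 by <:].
HB.instance Definition _ := [SubChoice_isSubLmodule of ell2 by <:].

End SquareSummable.

(** * The inner product and the norm of square summable sequences *)

Section DotProducts.
Variables (C : numClosedFieldType) (U : lmodType C).
Variable form : {dot U for @Num.conj C}.
Implicit Types u v : U.

(** Expand the squared norm of <v,v> u - <u,v> v, which is <v,v> times the
difference of the two sides. *)
Lemma dot_cauchy_schwarz u v :
  `|form u v| ^+ 2 <= form u u * form v v.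
Proof.
have [->|v_neq0] := eqVneq v 0.
  by rewrite linear0r normr0 expr0n /= mulr_ge0 // dnorm_ge0.
have v_gt0 : 0 < form v v by rewrite dnorm_gt0.
have vr : (form v v)^*%R = form v v by apply: conj_Creal; rewrite gtr0_real.
have := dnorm_ge0 form (form v v *: u - form u v *: v).
have cross : form (form v v *: u) (form u v *: v) = form v v * `|form u v| ^+ 2.
  by rewrite [LHS]linearZl_LR [X in _ * X]linearZr_LR /= [_^*%R * _]mulrC -normCK.
rewrite dnormB cross rmorphM /= vr.
rewrite (@conj_Creal _ (`|form u v| ^+ 2)) ?rpredX ?normr_real //.
rewrite (dnormZ form (form v v) u) (dnormZ form (form u v) v).
rewrite (ger0_norm (ltW v_gt0)).
rewrite (_ : _ - _ = form v v * (form u u * form v v - `|form u v| ^+ 2)).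
  by rewrite pmulr_rge0 // subr_ge0.
by ring.
Qed.

Lemma dot_le_sqrt u v :
  `|form u v| <= sqrtC (form u u) * sqrtC (form v v).
Proof.
rewrite -(@ler_pXn2r _ 2) ?nnegrE ?mulr_ge0 ?sqrt_dnorm_ge0 //.
by rewrite exprMn !sqrtCK dot_cauchy_schwarz.
Qed.

Lemma dot_triangle u v :
  sqrtC (form (u + v) (u + v)) <= sqrtC (form u u) + sqrtC (form v v).
Proof.
rewrite -(@ler_pXn2r _ 2) ?nnegrE ?addr_ge0 ?sqrt_dnorm_ge0 //.
rewrite sqrrD !sqrtCK dnormD addrAC lerD2r lerD2l -mulr_natr.
rewrite -[_ + _](divfK (negbT (pnatr_eq0 C 2))) ler_pM2r ?ltr0n //.
apply: le_trans (dot_le_sqrt u v).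
by have [] := leif_Re_Creal (form u v); rewrite ReE.
Qed.

End DotProducts.

Section Ell2Inner.
Variable R : realType.
Implicit Types u v w : ell2 R.

Definition sqnorm u : R := limn (series (fun k => sqmod (u k))).

Lemma series_sqmod_nd (f : nat -> R[i]) :
  nondecreasing_seq (series (fun k => sqmod (f k))).
Proof. by apply: nondecreasing_series => k _ _; exact: sqmod_ge0. Qed.

Lemma is_cvg_sqmod u : cvgn (series (fun k => sqmod (u k))).
Proof.
apply: nondecreasing_is_cvgn; first exact: series_sqmod_nd.
have /asboolP[M Mu] := ell2_valP u; exists M => _ [n _ <-]; exact: Mu.
Qed.

Lemma sum_sqmod_le u n : \sum_(0 <= k < n) sqmod (u k) <= sqnorm u.
Proof.
exact: nondecreasing_cvgn_le (@series_sqmod_nd u) (@is_cvg_sqmod u) n.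
Qed.

Lemma sqnorm_le u (M : R) :
  (forall n, \sum_(0 <= k < n) sqmod (u k) <= M) -> sqnorm u <= M.
Proof.
by move=> uM; apply: limr_le; [exact: is_cvg_sqmod | apply: nearW].
Qed.

Lemma sqnorm_ge0 u : 0 <= sqnorm u.
Proof. by have := sum_sqmod_le u 0; rewrite big_geq. Qed.

Lemma sqmod_le_sqnorm u k : sqmod (u k) <= sqnorm u.
Proof.
apply: le_trans (sum_sqmod_le u k.+1).
by rewrite big_nat_recr //= lerDr sumr_ge0 // => i _; exact: sqmod_ge0.
Qed.

(** Both components of [u k * (v k)^*] are bounded by [sqmod (u k) + sqmod (v k)],
so the inner product converges absolutely. *)
Lemma csummable_mul_conj u v : csummable (fun k => u k * (v k)^*%C).
Proof.
have cuv : cvgn (series (fun k => sqmod (u k) + sqmod (v k))).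
  by apply: is_cvg_seriesD; exact: is_cvg_sqmod.
have ge0 k : 0 <= sqmod (u k) + sqmod (v k) by rewrite addr_ge0 ?sqmod_ge0.
split; apply: normed_cvg; apply: series_le_cvg cuv => //= k.
  exact: Re_mul_conj_le.
exact: Im_mul_conj_le.
Qed.

Definition ell2_inner u v : R[i] := csum (fun k => u k * (v k)^*%C).

Lemma ell2_innerC u v : ell2_inner u v = (ell2_inner v u)^*%C.
Proof.
rewrite /ell2_inner -csum_conj; last exact: csummable_mul_conj.
by congr csum; apply/funext => k; rewrite rmorphM /= conjcK mulrC.
Qed.

Lemma ell2_inner_linear v (a : R[i]) u w :
  ell2_inner (a *: u + w) v = a * ell2_inner u v + ell2_inner w v.
Proof.
rewrite /ell2_inner -csum_linear; [|exact: csummable_mul_conj..].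
by congr csum; apply/funext => k; rewrite mulrDl mulrA.
Qed.

Lemma ell2_inner_self u : ell2_inner u u = (sqnorm u)%:C.
Proof.
rewrite /ell2_inner /csum /sqnorm.
have -> : (fun k => Re (u k * (u k)^*%C)) = (fun k => sqmod (u k)).
  by apply/funext => k; rewrite mul_conjc.
have -> : (fun k => Im (u k * (u k)^*%C)) = (fun=> 0).
  by apply/funext => k; rewrite mul_conjc.
congr (_ +i* _); rewrite (_ : series _ = fun=> 0) ?lim_cst //.
by apply/funext => n; rewrite /series /= big1.
Qed.

Lemma ell2_inner_bilinear :
  bilinear_for *%R (@Num.conj R[i] \; *%R) ell2_inner.
Proof.
split=> v a x y; first exact: ell2_inner_linear.
rewrite /= ell2_innerC ell2_inner_linear rmorphD rmorphM /=.
by rewrite (ell2_innerC v x) (ell2_innerC v y).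
Qed.

HB.instance Definition _ := bilinear_isBilinear.Build R[i] (ell2 R) (ell2 R)
  R[i] *%R (@Num.conj R[i] \; *%R) ell2_inner ell2_inner_bilinear.

Lemma ell2_inner_hermitian u v :
  ell2_inner u v = (-1) ^+ false * Num.conj (ell2_inner v u).
Proof. by rewrite expr0 mul1r ell2_innerC. Qed.

HB.instance Definition _ := isHermitianSesquilinear.Build R[i] (ell2 R) false
  (@Num.conj R[i]) ell2_inner ell2_inner_hermitian.

Lemma ell2_inner_gt0 u : u != 0 -> 0 < ell2_inner u u.
Proof.
move=> u_neq0; rewrite ell2_inner_self ltcR lt_neqAle sqnorm_ge0 andbT.
apply: contra_neq u_neq0 => u0; apply/val_inj/funext => k /=.
by apply/eqP; rewrite -sqmod_eq0 eq_le sqmod_ge0 andbT u0 sqmod_le_sqnorm.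
Qed.

HB.instance Definition _ :=
  isDotProduct.Build R[i] (ell2 R) ell2_inner ell2_inner_gt0.

Definition ell2_norm u : R[i] := sqrtC (ell2_inner u u).

Lemma ell2_norm_triangle u v : ell2_norm (u + v) <= ell2_norm u + ell2_norm v.
Proof. exact: dot_triangle. Qed.

Lemma ell2_normZ (a : R[i]) u : ell2_norm (a *: u) = `|a| * ell2_norm u.
Proof.
rewrite /ell2_norm dnormZ sqrtCM ?nnegrE ?exprn_ge0 ?dnorm_ge0 //.
by rewrite sqrCK.
Qed.

Lemma ell2_norm_eq0 u : ell2_norm u = 0 -> u = 0.
Proof. by move/eqP; rewrite sqrt_dnorm_eq0 => /eqP. Qed.

HB.instance Definition _ := @Lmodule_isNormed.Build R[i] (ell2 R)
  ell2_norm ell2_norm_triangle ell2_normZ ell2_norm_eq0.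

Lemma ell2_normE u : `|u| = (Num.sqrt (sqnorm u))%:C.
Proof.
apply/eqP; rewrite -(@eqrXn2 _ 2) ?lecR ?sqrtr_ge0 //.
rewrite [X in X == _]sqrtCK ell2_inner_self -rmorphXn /=.
by rewrite sqr_sqrtr ?sqnorm_ge0.
Qed.

Lemma ell2_sqr_norm u : `|u| ^+ 2 = ell2_inner u u.
Proof. exact: sqrtCK. Qed.

End Ell2Inner.

(** * Completeness of the sequence space *)

Section Ell2Complete.
Variable R : realType.
Implicit Types u v : ell2 R.

Lemma square_summable_ell2 u : square_summable u.
Proof. by have /asboolP := ell2_valP u. Qed.

(** A finite partial sum is a continuous function of finitely many coordinates,
so a bound on the distance to [u] survives coordinatewise limits. *)
Lemma sqmod_coord_near (F : set_system (ell2 R)) (FF : ProperFilter F) u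
    (l : nat -> R[i]) (e : R) n :
  (forall k, (fun v : ell2 R => Re (v k)) @ F --> Re (l k)) ->
  (forall k, (fun v : ell2 R => Im (v k)) @ F --> Im (l k)) ->
  (\forall v \near F, sqnorm (v - u) <= e) ->
  \sum_(0 <= k < n) sqmod (l k - u k) <= e.
Proof.
move=> lr li Fe.
have cv : (fun v : ell2 R => \sum_(0 <= k < n) sqmod ((v - u) k)) @ F
    --> \sum_(0 <= k < n) sqmod (l k - u k).
  apply: cvg_big => [|k _]; first exact: add_continuous.
  have E z : sqmod (z - u k) =
      (Re z - Re (u k)) * (Re z - Re (u k))
      + (Im z - Im (u k)) * (Im z - Im (u k)).
    by rewrite /sqmod !expr2; case: z (u k) => [? ?] [? ?].
  rewrite E (_ : (fun v : ell2 R => _) = (fun v : ell2 R =>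
      (Re (v k) - Re (u k)) * (Re (v k) - Re (u k))
      + (Im (v k) - Im (u k)) * (Im (v k) - Im (u k)))); last first.
    by apply/funext => v; exact: E.
  by apply: cvgD; apply: cvgM; apply: cvgB;
    first [exact: lr | exact: li | exact: cvg_cst].
rewrite -(cvg_lim _ cv) //; apply: limr_le.
  by apply/cvg_ex; eexists; exact: cv.
by near=> v; apply: le_trans (sum_sqmod_le _ _) _; near: v.
Unshelve. all: by end_near. Qed.

Lemma ell2_norm_lt u (e : R) : (`|u| < e%:C) = (Num.sqrt (sqnorm u) < e).
Proof. by rewrite ell2_normE ltcR. Qed.

Lemma Re_coord_le u k : `|Re (u k)| <= Num.sqrt (sqnorm u).
Proof.
rewrite -sqrtr_sqr ler_wsqrtr //; apply: le_trans (sqmod_le_sqnorm u k).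
by rewrite lerDl sqr_ge0.
Qed.

Lemma Im_coord_le u k : `|Im (u k)| <= Num.sqrt (sqnorm u).
Proof.
rewrite -sqrtr_sqr ler_wsqrtr //; apply: le_trans (sqmod_le_sqnorm u k).
by rewrite lerDr sqr_ge0.
Qed.

(** For [f] the real or imaginary part of a coordinate; the hypothesis says that
[f] is 1-Lipschitz. *)
Lemma coord_cauchy_cvg (F : set_system (ell2 R)) (FF : ProperFilter F)
    (f : ell2 R -> R) :
  (forall u v, `|f u - f v| <= Num.sqrt (sqnorm (u - v))) ->
  cauchy F -> cvg (f @ F).
Proof.
move=> f_le /cauchy_ballP Fc; apply: cauchy_cvg; apply/cauchy_ballP => e e0.
have /Fc [[P Q] /= [FP FQ] PQ] : 0 < e%:C by rewrite ltcR.
exists (f @` P, f @` Q).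
  by split=> /=; [apply: filterS FP | apply: filterS FQ] => x Px; exists x.
move=> [_ _] /= [[x Px <-] [y Qy <-]].
rewrite /ball /=; apply: le_lt_trans (f_le x y) _; rewrite -ell2_norm_lt.
have := PQ (x, y) (conj Px Qy).
by rewrite -ball_normE.
Qed.

(** The coordinates of a Cauchy filter converge to some sequence [l]. Partial sums
of [l - u] are small for [u] far in the filter, uniformly in their length, so
that [l - u] and hence [l] is square summable and the filter converges to [l]
in norm. *)
Lemma ell2_complete (F : set_system (ell2 R)) :
  ProperFilter F -> cauchy F -> cvg F.
Proof.
move=> FF Fc.
have cr k : cvg ((fun u : ell2 R => Re (u k)) @ F).
  apply: coord_cauchy_cvg Fc => u v; apply: le_trans (Re_coord_le (u - v) k).
  by rewrite -raddfB.
have ci k : cvg ((fun u : ell2 R => Im (u k)) @ F).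
  apply: coord_cauchy_cvg Fc => u v; apply: le_trans (Im_coord_le (u - v) k).
  by rewrite -raddfB.
pose l k := lim ((fun u : ell2 R => Re (u k)) @ F)
         +i* lim ((fun u : ell2 R => Im (u k)) @ F).
have near_l (e : R) : 0 < e -> exists2 A, F A &
    forall u, A u -> forall n, \sum_(0 <= k < n) sqmod (l k - u k) <= e ^+ 2.
  move=> e0; move/cauchy_ballP : (Fc) => Fb.
  have /Fb [[P Q] /= [FP FQ] PQ] : 0 < e%:C by rewrite ltcR.
  exists P => // u Pu n.
  apply: (@sqmod_coord_near F _ u l (e ^+ 2) n); [exact: cr | exact: ci |].
  apply: filterS FQ => v Qv; have := PQ (u, v) (conj Pu Qv).
  rewrite -ball_normE /= distrC ell2_norm_lt => /ltW.
  rewrite -(@ler_pXn2r _ 2) ?nnegrE ?sqrtr_ge0 ?(ltW e0) //.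
  by rewrite sqr_sqrtr ?sqnorm_ge0.
have l_in : l \in @ell2_pred R.
  have [A FA Al] := near_l 1 ltr01.
  have [u Au] := filter_ex FA.
  have lu : (l - u : nat -> R[i]) \in @ell2_pred R.
    by apply/asboolP; exists (1 ^+ 2); exact: Al.
  by rewrite -(subrK (u : nat -> R[i]) l) rpredD // ell2_valP.
apply/cvg_ex; exists (Ell2 l_in); apply/cvgrPdist_le => e e0.
have er : e = (Re e)%:C by rewrite RRe_real // gtr0_real.
have Re0 : 0 < Re e by rewrite -ltcR -er.
have [A FA Al] := near_l _ Re0.
apply: filterS FA => u Au; rewrite er ell2_normE lecR.
rewrite -(@ler_pXn2r _ 2) ?nnegrE ?sqrtr_ge0 ?(ltW Re0) //.
by rewrite sqr_sqrtr ?sqnorm_ge0 //; apply: sqnorm_le; exact: Al.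
Qed.

HB.instance Definition _ := Uniform_isComplete.Build (ell2 R) ell2_complete.

HB.instance Definition _ := CompleteNormedModule_isHilbert.Build R (ell2 R)
  (@ell2_sqr_norm R).

End Ell2Complete.

(** * Bounded linear maps *)

Section BoundedMaps.
Variable R : realType.
Implicit Types H K L : hilbertType R.

Definition bounded_map H K (f : H -> K) : Prop :=
  exists M : R, forall x, `|f x| <= M%:C * `|x|.

Lemma bounded_map_ge0 H K (f : H -> K) : bounded_map f ->
  exists2 M : R, 0 <= M & forall x, `|f x| <= M%:C * `|x|.
Proof.
move=> [M fM]; exists `|M| => // x; apply: le_trans (fM x) _.
by rewrite ler_wpM2r // lecR ler_norm.
Qed.

Lemma bounded_map_comp H K (L : hilbertType R) (f : H -> K) (g : K -> L) :
  bounded_map f -> bounded_map g -> bounded_map (g \o f).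
Proof.
move=> [M fM] /bounded_map_ge0[N N0 gN]; exists (N * M) => x /=.
apply: le_trans (gN _) _; rewrite rmorphM /= -mulrA ler_wpM2l ?lecR //.
Qed.

Lemma bounded_map_sum H K n (f : 'I_n -> H -> K) :
  (forall j, bounded_map (f j)) -> bounded_map (fun x => \sum_(j < n) f j x).
Proof.
move=> /choice[M fM]; exists (\sum_(j < n) M j) => x.
apply: le_trans (ler_norm_sum _ _ _) _.
by rewrite rmorph_sum mulr_suml; apply: ler_sum => j _; exact: fM.
Qed.

Lemma inner_bound H (x y : H) : `|inner x y| <= `|x| * `|y|.
Proof.
rewrite -(@ler_pXn2r _ 2) ?nnegrE ?mulr_ge0 // exprMn !sqr_normE.
exact: dot_cauchy_schwarz.
Qed.

Lemma bounded_map_rank1 H K (y : H) (z : K) :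
  bounded_map (fun x : H => inner x y *: z).
Proof.
exists (Re (`|y| * `|z|)) => x.
have -> : (Re (`|y| * `|z|))%:C = `|y| * `|z|.
  by rewrite RRe_real // ger0_real // mulr_ge0.
by rewrite normrZ mulrAC ler_wpM2r // mulrC inner_bound.
Qed.

End BoundedMaps.

Definition bounded_linear (R : realType) (H K : hilbertType R) (f : H -> K)
    (f_linear : linear f)
    (f_bounded : bounded_map f) :
    bounded_operator H K :=
  @BoundedOperator R H K
    (HB.pack_for {linear H -> K} f
      (GRing.isLinear.Build R[i] H K *:%R f f_linear)) f_bounded.

(** * A pair of operators whose only intertwiners are scalars *)

Section KroneckerPair.
Variable R : realType.
Local Notation seqC := (nat -> R[i]).
Implicit Types (u x : ell2 R) (f : seqC -> seqC).

Lemma ell2_norm_coord u k : `|u k| <= `|u|.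
Proof.
rewrite -(@ler_pXn2r _ 2) ?nnegrE // -sqmodE ell2_sqr_norm ell2_inner_self lecR.
exact: sqmod_le_sqnorm.
Qed.

Lemma ell2_norm_le_sum u (v : ell2 R) :
  (forall n, \sum_(0 <= k < n) sqmod (u k) <= \sum_(0 <= k < n) sqmod (v k)) ->
  `|u| <= `|v|.
Proof.
move=> uv; rewrite !ell2_normE lecR ler_wsqrtr //; apply: sqnorm_le => n.
exact: le_trans (uv n) (sum_sqmod_le v n).
Qed.

(** Linear maps of sequences that do not increase any partial sum of squared
moduli; the shift and the diagonal operator are of this kind. *)
Section Contraction.
Variable f : seqC -> seqC.
Hypothesis f_linear : linear f.
Hypothesis f_contr : forall (u : seqC) n,
  \sum_(0 <= k < n) sqmod (f u k) <= \sum_(0 <= k < n) sqmod (u k).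

Lemma contraction_subproof u : f u \in @ell2_pred R.
Proof.
have [M uM] := square_summable_ell2 u.
by apply/asboolP; exists M => n; exact: le_trans (f_contr u n) (uM n).
Qed.

Definition contraction_fun u : ell2 R := Ell2 (contraction_subproof u).

Lemma contraction_fun_linear : linear contraction_fun.
Proof. by move=> a u v; apply: val_inj; exact: f_linear. Qed.

Lemma contraction_fun_bounded : bounded_map contraction_fun.
Proof.
by exists 1 => u; rewrite mul1r; apply: ell2_norm_le_sum => n; exact: f_contr.
Qed.

Definition contraction : bounded_operator (ell2 R) (ell2 R) :=
  bounded_linear contraction_fun_linear contraction_fun_bounded.

End Contraction.

Definition shift_seq (u : seqC) : seqC := fun k => if k is j.+1 then u j else 0.

Definition weight_seq (u : seqC) : seqC := fun k => (k.+1%:R)^-1 * u k.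

Lemma shift_seq_linear : linear shift_seq.
Proof.
move=> a u v; apply/funext => -[|k] //.
by change (0 = a * 0 + 0 :> R[i]); rewrite mulr0 addr0.
Qed.

Lemma weight_seq_linear : linear weight_seq.
Proof.
move=> a u v; apply/funext => k; rewrite /weight_seq mulrDr.
by congr (_ + _); exact: mulrCA.
Qed.

Lemma shift_seq_contr (u : seqC) n :
  \sum_(0 <= k < n) sqmod (shift_seq u k) <= \sum_(0 <= k < n) sqmod (u k).
Proof.
case: n => [|n]; first by rewrite !big_geq.
rewrite big_nat_recl // [sqmod _](_ : _ = 0); last first.
  by rewrite /sqmod /= expr0n addr0.
by rewrite add0r [leRHS]big_nat_recr //= lerDl sqmod_ge0.
Qed.

Lemma weight_seq_contr (u : seqC) n :
  \sum_(0 <= k < n) sqmod (weight_seq u k) <= \sum_(0 <= k < n) sqmod (u k).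
Proof.
apply: ler_sum => k _; rewrite -lecR !sqmodE normrM exprMn.
apply: ler_piMl; first by rewrite exprn_ge0.
by rewrite exprn_ile1 // normfV normr_nat invf_le1 ?ltr0n // ler1n.
Qed.

Definition shift := contraction shift_seq_linear shift_seq_contr.
Definition weight := contraction weight_seq_linear weight_seq_contr.

Lemma shiftE u k : shift u k = shift_seq u k. Proof. by []. Qed.
Lemma weightE u k : weight u k = (k.+1%:R)^-1 * u k. Proof. by []. Qed.

Lemma sum_sqmod_delta_le j n :
  \sum_(0 <= k < n) sqmod ((k == j)%:R : R[i]) <= 1.
Proof.
case: (ltnP j n) => [jn|nj].
  rewrite (bigD1_seq j) ?mem_index_iota ?iota_uniq //= eqxx big1.
    by rewrite addr0 /sqmod /= expr0n /= addr0 expr1n.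
  by move=> k /negbTE ->; rewrite /sqmod /= expr0n addr0.
rewrite big_nat_cond big1 ?ler01 // => k /andP[/andP[_ kn] _].
by rewrite ltn_eqF ?(leq_trans kn) // /sqmod /= expr0n addr0.
Qed.

Lemma basis_subproof j : (fun k : nat => (k == j)%:R : R[i]) \in @ell2_pred R.
Proof. by apply/asboolP; exists 1; exact: sum_sqmod_delta_le. Qed.

Definition basis j : ell2 R := Ell2 (basis_subproof j).

Lemma basisE j k : basis j k = (k == j)%:R. Proof. by []. Qed.

Lemma norm_basis_le1 j : `|basis j| <= 1.
Proof.
rewrite ell2_normE lecR -sqrtr1 ler_wsqrtr //.
by apply: sqnorm_le; exact: sum_sqmod_delta_le.
Qed.

Lemma shift_basis j : shift (basis j) = basis j.+1.
Proof. by apply/val_inj/funext => -[|k]. Qed.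

Lemma weight_basis j : weight (basis j) = (j.+1%:R)^-1 *: basis j.
Proof.
apply/val_inj/funext => k; change ((k.+1%:R)^-1 * basis j k
  = (j.+1%:R)^-1 * basis j k).
by rewrite basisE; case: eqP => [->//|_]; rewrite !mulr0.
Qed.

Lemma unshift_subproof u : (fun k : nat => u k.+1) \in @ell2_pred R.
Proof.
have [M uM] := square_summable_ell2 u; apply/asboolP; exists M => n.
apply: le_trans (uM n.+1); rewrite big_nat_recl // lerDr; exact: sqmod_ge0.
Qed.

Definition unshift u : ell2 R := Ell2 (unshift_subproof u).

Lemma shift_decomp u : u = u 0%N *: basis 0 + shift (unshift u).
Proof.
apply/val_inj/funext => -[|k].
  by change (u 0%N = u 0%N * 1 + 0); rewrite mulr1 addr0.
by change (u k.+1 = u 0%N * 0 + u k.+1); rewrite mulr0 add0r.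
Qed.

(** In the bases, [weight] has matrix diag(1/(k+1)) and [shift] sends each basis
vector to the next, so the hypotheses give
T2 (i+1, j+1) = (i+1)/(j+1) T2 (i, j). Starting from an entry in row d+1 of
column 0, the modulus at step i along the diagonal is at least i+1 times the
initial one, whereas it is at most the norm of [T2]: column 0 of [T2] vanishes
below its first entry [c]. Splitting x as x_0 e_0 + B x' and applying the two
relations alternately then computes the coordinates of T2 x one after the other,
without any density argument. *)
Lemma kronecker_scalar (T1 T2 : bounded_operator (ell2 R) (ell2 R)) :
  (forall x, T2 (weight x) = weight (T1 x)) ->
  (forall x, T2 (shift x) = shift (T1 x)) ->
  exists c : R[i], (forall x, T1 x = c *: x) /\ (forall x, T2 x = c *: x).
Proof.
move=> TW TS.
have Sneq0 k : k.+1%:R != 0 :> R[i] by rewrite pnatr_eq0.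
have T1E x i : T1 x i = i.+1%:R * T2 (weight x) i.
  by rewrite TW weightE mulVKf.
have diag i j : T2 (basis j.+1) i.+1 = i.+1%:R / j.+1%:R * T2 (basis j) i.
  rewrite -shift_basis TS shiftE /= T1E weight_basis linearZ.
  by rewrite -mulrA.
have grow d i : i.+1%:R * `|T2 (basis 0) d.+1| <= `|T2 (basis i) (i + d.+1)%N|.
  elim: i => [|i IHi]; first by rewrite mul1r.
  rewrite addSn diag normrM normf_div !normr_nat.
  have H : i.+2%:R <= (i + d.+1)%N.+1%:R :> R[i] by rewrite ler_nat; lia.
  apply: le_trans (_ : (i + d.+1)%N.+1%:R / i.+1%:R
      * (i.+1%:R * `|T2 (basis 0) d.+1|) <= _).
    by rewrite mulrA divfK // ler_wpM2r.
  by apply: ler_wpM2l IHi; rewrite divr_ge0 ?ler0n.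
have col0 d : T2 (basis 0) d.+1 = 0.
  have [M TM] := operator_bounded T2.
  apply/eqP; rewrite -normr_eq0; apply/negP => /negP d_neq0.
  have d_gt0 : 0 < `|T2 (basis 0) d.+1| by rewrite lt_def d_neq0 normr_ge0.
  set t := `|_| in d_gt0.
  have tr : t = (Re t)%:C by rewrite RRe_real // normr_real.
  have bound i : i.+1%:R * Re t <= `|M|.
    rewrite -lecR rmorphM rmorph_nat /= -tr; apply: le_trans (grow d i) _.
    apply: le_trans (ell2_norm_coord _ _) _; apply: le_trans (TM _) _.
    apply: le_trans (_ : `|M|%:C * `|basis i| <= _).
      by rewrite ler_wpM2r // lecR ler_norm.
    by rewrite ler_piMr ?norm_basis_le1 // lecR.
  have t_gt0 : 0 < Re t by rewrite -ltcR -tr.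
  have := bound (Num.Def.archi_bound (`|M| / Re t)).
  rewrite -ler_pdivlMr // leNgt => /negP; apply.
  apply: lt_trans (archi_boundP _) _; first by rewrite divr_ge0 // ltW.
  by rewrite ltr_nat.
pose c := T2 (basis 0) 0%N.
have T2E i x : T2 x i = c * x i.
  elim: i x => [|i IHi] x; rewrite {1}(shift_decomp x) linearD linearZ /= TS.
    change (x 0%N * c + 0 = c * x 0%N); by rewrite addr0 mulrC.
  change (x 0%N * T2 (basis 0) i.+1 + T1 (unshift x) i = c * x i.+1).
  rewrite col0 mulr0 add0r T1E IHi weightE.
  by rewrite mulrCA mulVKf.
exists c; split=> x; apply/val_inj/funext => i; last exact: T2E.
by change (T1 x i = c * x i); rewrite T1E T2E weightE mulrCA mulVKf.
Qed.

(** If d vectors spanned, the identity matrix of size d+1 would factor through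
dimension d: the first d+1 coordinates of the first d+1 basis vectors. *)
Lemma ell2_not_finite_dimensional : ~ finite_dimensional (ell2 R).
Proof.
move=> [d [b bP]].
pose A := \matrix_(i < d, k < d.+1) b i (nat_of_ord k).
have [C CE] : exists C : 'M[R[i]]_(d.+1, d), C *m A = 1%:M.
  have /choice[c cE] : forall j : 'I_d.+1, exists c : 'I_d -> R[i],
    basis j = \sum_(i < d) c i *: b i.
    by move=> j; exact: bP.
  exists (\matrix_(j, i) c j i); apply/matrixP => j k.
  rewrite !mxE; under eq_bigr do rewrite !mxE.
  transitivity (basis j k); last by rewrite basisE eq_sym.
  by rewrite cE (big_morph (fun u : ell2 R => u k) (id1 := 0) (op1 := +%R)).
have := mulmx_max_rank C A; rewrite CE mxrank1; by rewrite ltnn.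
Qed.

End KroneckerPair.

(** * Systems of operators around an oriented cycle *)

(** [pr] is the predecessor on a union of oriented cycles of length [m], and [F w]
the operator of the arrow that enters [w]. Indexing arrows by their end makes
[push] an honest map on families of vectors, so that composites along paths
need no transport between vertices. *)
Section CyclicSystem.
Variables (R : realType) (V : eqType) (H : V -> hilbertType R) (pr : V -> V).
Variable F : forall w, bounded_operator (H (pr w)) (H w).
Variable m : nat.
Hypothesis pr_period : forall w, iter m pr w = w.
Hypothesis pr_aperiodic :
  forall w j, (0 < j)%N -> (j < m)%N -> iter j pr w != w.

Local Notation family := (forall v, H v).
Implicit Types d : family.

Definition push d : family := fun w => F w (d (pr w)).

Definition single v (x : H v) : family := @dfwith _ _ (fun w => 0 : H w) v x.

Lemma single_in v (x : H v) : single x v = x.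
Proof. exact: dfwithin. Qed.

Lemma single_out v (x : H v) w : v != w -> single x w = 0.
Proof. exact: dfwithout. Qed.

Lemma single_linear v (a : R[i]) (x y : H v) w :
  single (a *: x + y) w = a *: single x w + single y w.
Proof.
have [<-|vw] := eqVneq v w; first by rewrite !single_in.
by rewrite !single_out // scaler0 addr0.
Qed.

Lemma iter_push_linear j (a : R[i]) d d' d'' :
  (forall w, d'' w = a *: d w + d' w) ->
  forall w, iter j push d'' w = a *: iter j push d w + iter j push d' w.
Proof.
move=> dE; elim: j => [|j IHj] w //.
by rewrite /= /push IHj linearP.
Qed.

Lemma iter_push_single_bounded j v w :
  bounded_map (fun x : H v => iter j push (single x) w).
Proof.
elim: j w => [|j IHj] w /=.
  exists 1 => x; rewrite mul1r.
  have [<-|vw] := eqVneq v w; first by rewrite single_in.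
  by rewrite single_out // normr0.
exact: bounded_map_comp (IHj (pr w)) (operator_bounded (F w)).
Qed.

(** The value at [w] after j steps only depends on the vector that sits j steps
before [w]. *)
Lemma iter_push_coord j d d' w :
  d (iter j pr w) = d' (iter j pr w) -> iter j push d w = iter j push d' w.
Proof.
elim: j w => [|j IHj] w //; rewrite iterSr => dd'.
by rewrite /= /push IHj.
Qed.

Lemma iter_push0 j d w : d (iter j pr w) = 0 -> iter j push d w = 0.
Proof.
move=> d0; rewrite (@iter_push_coord j d (fun v => 0 : H v)) //.
by elim: j w {d0} => [|j IHj] w //=; rewrite /push IHj linear0.
Qed.

Hypothesis m_gt0 : (0 < m)%N.

Lemma pr_inj : injective pr.
Proof.
apply: (can_inj (g := iter m.-1 pr)) => w.
by rewrite -iterSr prednK.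
Qed.

Lemma push_single w (x : H (pr w)) : push (single x) = single (F w x).
Proof.
apply: functional_extensionality_dep => v; rewrite /push.
have [<-|wv] := eqVneq w v; first by rewrite !single_in.
by rewrite !single_out ?linear0 // (inj_eq pr_inj).
Qed.

Lemma iter_push_single j w (x : H (pr w)) :
  iter j push (single (F w x)) = iter j.+1 push (single x).
Proof. by rewrite -push_single iterSr. Qed.

Definition intertwining (T : forall v, bounded_operator (H v) (H v)) : Prop :=
  forall w x, T w (F w x) = F w (T (pr w) x).

Hypothesis only_scalars : forall T, intertwining T ->
  exists c : R[i], forall v x, T v x = c *: x.

(** Going once around the cycle commutes with every [F w], hence is an
endomorphism and so a scalar. *)
Lemma iter_push_period_scalar :
  exists c : R[i], forall d w, iter m push d w = c *: d w.
Proof.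
have lin v : linear (fun x : H v => iter m push (single x) v).
  by move=> a x y; apply: iter_push_linear => w; exact: single_linear.
pose T v := bounded_linear (lin v) (iter_push_single_bounded m v v).
have [|c Tc] := only_scalars (T := T).
  by move=> w x /=; rewrite iter_push_single.
exists c => d w; rewrite -(Tc w) /=.
apply: iter_push_coord; rewrite pr_period.
by rewrite single_in.
Qed.

Section Telescope.
Variables (k : nat) (mu : R[i]).
Hypothesis push_power : forall d w, iter k.+1 push d w = mu *: d w.
Variables (w0 : V) (y : H w0) (xi : family).

(** Block at [v] of sum_(j <= k) N^j X N^(k-j), where N is [push] and X sends a
family d to <d w0, y> xi. *)
Definition telescope_fun v (x : H v) : H v :=
  \sum_(j < k.+1) inner (iter (k - j) push (single x) w0) y *: iter j push xi v.

Lemma telescope_fun_linear v : linear (@telescope_fun v).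
Proof.
move=> a x x'; rewrite /telescope_fun scaler_sumr -big_split /=.
apply: eq_bigr => j _.
rewrite (iter_push_linear (k - j) (single_linear a x x')).
by rewrite linearPl /= scalerDl scalerA.
Qed.

Lemma telescope_fun_bounded v : bounded_map (@telescope_fun v).
Proof.
apply: bounded_map_sum => j.
exact: bounded_map_comp (iter_push_single_bounded (k - j) v w0)
  (bounded_map_rank1 y (iter j push xi v)).
Qed.

Definition telescope v : bounded_operator (H v) (H v) :=
  bounded_linear (@telescope_fun_linear v) (@telescope_fun_bounded v).

(** The two composites are the same sum up to a shift of the index; the two
remaining end terms agree because N^(k+1) is the scalar [mu]. *)
Lemma telescope_intertwining : intertwining telescope.
Proof.
move=> w x.
pose g i := inner (iter i push (single x) w0) y.
transitivity (\sum_(j < k.+1) g (k - j).+1 *: iter j push xi w).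
  by rewrite /= /telescope_fun; apply: eq_bigr => j _; rewrite iter_push_single.
transitivity (\sum_(j < k.+1) g (k - j)%N *: iter j.+1 push xi w); last first.
  by rewrite /= /telescope_fun linear_sum; apply: eq_bigr => j _; rewrite linearZ.
rewrite big_ord_recl big_ord_recr /= addrC subn0 subnn; congr (_ + _); last first.
  by apply: eq_bigr => j _; rewrite /bump /= add1n subnSK.
have -> : push (iter k push xi) w = mu *: xi w by exact: push_power.
by rewrite /g push_power linearZl_LR /= scalerA mulrC.
Qed.

End Telescope.

(** With k maximal such that N^k <> 0, take y = (N^k d) w0 <> 0 and let xi be the
vector x0 of d that contributes to y, placed at its vertex u. The telescoping
endomorphism sends x0 to |y|^2 x0: its terms with 0 < j <= k < m vanish at u,
since fewer than m steps do not return to u. So it is a non-zero scalar, whose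
block at v has its range in the span of the k+1 vectors (N^j xi) v. *)
Lemma cyclic_system_finite_dimensional (u1 : V) (x1 : H u1) :
  x1 != 0 -> forall v, finite_dimensional (H v).
Proof.
move=> x1_neq0.
have [lam lamE] := iter_push_period_scalar.
pose P k := (k < m)%N && `[< exists d w, iter k push d w != 0 >].
have exP : exists k, P k.
  exists 0%N; rewrite /P m_gt0; apply/asboolP; exists (single x1), u1.
  by rewrite /= single_in.
have leP k : P k -> (k <= m)%N by case/andP => /ltnW.
have [k /andP[km /asboolP[d [w0 y_neq0]]] k_max] := ex_maxnP exP leP.
have [mu muE] : exists mu : R[i], forall d w, iter k.+1 push d w = mu *: d w.
  have [mk|mk] := leqP m k.+1.
    by have -> : k.+1 = m by [apply/eqP; rewrite eqn_leq km]; exists lam.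
  exists 0 => d' w; rewrite scale0r; apply/eqP/negPn/negP => nz.
  have : P k.+1 by rewrite /P mk; apply/asboolP; exists d', w.
  by move/k_max; rewrite ltnn.
set y := iter k push d w0 in y_neq0; set u := iter k pr w0; set x0 := d u.
have yE : iter k push (single x0) w0 = y.
  by apply: iter_push_coord; rewrite -/u single_in.
pose T := telescope k y (single x0).
have [c Tc] := only_scalars (telescope_intertwining muE y (single x0)).
have Tu : T u x0 = inner y y *: x0.
  rewrite /= /telescope_fun big_ord_recl /= subn0 yE single_in big1 ?addr0 //.
  move=> j _; rewrite [X in _ *: X](@iter_push0 j.+1) ?scaler0 //.
  apply: single_out; rewrite eq_sym; apply: pr_aperiodic => //.
  by apply: leq_ltn_trans km; exact: ltn_ord.
have x0_neq0 : x0 != 0.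
  apply: contra_neq y_neq0 => x00; rewrite -yE iter_push0 // -/u.
  by rewrite single_in.
have c_neq0 : c != 0.
  apply/eqP => c0; move: Tu; rewrite /T Tc c0 scale0r => /esym/eqP.
  by rewrite scaler_eq0 (negbTE x0_neq0) orbF dnorm_eq0 (negbTE y_neq0).
move=> v; exists k.+1, (fun j => iter j push (single x0) v) => x.
exists (fun j => c^-1 * inner (iter (k - j) push (single x) w0) y).
transitivity (c^-1 *: T v x); first by rewrite /T Tc scalerA mulVf // scale1r.
by rewrite /= /telescope_fun scaler_sumr; apply: eq_bigr => j _; rewrite scalerA.
Qed.

End CyclicSystem.

(** * Quivers whose underlying graph is a cycle *)

Section CyclicSuccessor.

Lemma val_iter_ordS m (i : 'I_m) j :
  iter j (@ordS m) i = ((i + j) %% m)%N :> nat.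
Proof.
elim: j => [|j IHj]; first by rewrite addn0 modn_small.
by rewrite iterS [LHS]/= IHj addnS -addn1 modnDml addn1.
Qed.

Lemma iter_ordS_period m (i : 'I_m) : iter m (@ordS m) i = i.
Proof. by apply: val_inj; rewrite /= val_iter_ordS modnDr modn_small. Qed.

Lemma iter_ordS_aperiodic m (i : 'I_m) j :
  (0 < j)%N -> (j < m)%N -> iter j (@ordS m) i != i.
Proof.
move=> j0 jm; apply/eqP => /(congr1 val) /=; rewrite val_iter_ordS.
have [ijm|mij] := ltnP (i + j) m; first by rewrite modn_small //; lia.
have -> : (i + j = (i + j - m) + m)%N by rewrite subnK.
by rewrite modnDr modn_small; have := ltn_ord i; lia.
Qed.

Lemma iter_ordS_reach n (i0 i : 'I_n.+1) :
  exists2 j, (j <= n)%N & i = iter j (@ordS n.+1) i0.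
Proof.
exists ((i + (n.+1 - i0)) %% n.+1)%N; first by rewrite -ltnS ltn_mod.
apply: val_inj; rewrite /= val_iter_ordS modnDmr addnCA subnKC; last first.
  by rewrite ltnW.
by rewrite modnDr modn_small.
Qed.

Lemma iter_ord_predK m j : cancel (iter j (@ord_pred m)) (iter j (@ordS m)).
Proof.
by elim: j => [|j IHj] i //; rewrite iterSr iterS ord_predK IHj.
Qed.

Lemma ordS_rev_ordS n (i : 'I_n.+1) : ordS (rev_ord (ordS i)) = rev_ord i.
Proof.
apply: val_inj => /=; have := ltn_ord i; rewrite ltnS leq_eqVlt => /orP[/eqP->|lt_in].
  by rewrite modnn subn1 /= modnn subnn.
by rewrite (@modn_small i.+1) // subSS modn_small; lia.
Qed.

Lemma ordS_neq n (i : 'I_n.+1) : (0 < n)%N -> ordS i != i.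
Proof. by move=> n0; apply: (@iter_ordS_aperiodic n.+1 i 1). Qed.

End CyclicSuccessor.

(** The arrow entering [w] ends at [w] only up to a propositional equality [e]. *)
Lemma intertwining_cast (R : realType) (V : Type) (H : V -> hilbertType R)
    (T : forall v, bounded_operator (H v) (H v)) (s t w : V) (e : t = w)
    (f : bounded_operator (H s) (H t)) (x : H s) :
  let f' := ecast v (bounded_operator (H s) (H v)) e f in
  T w (f' x) = f' (T s x) -> T t (f x) = f (T s x).
Proof. by case: w / e. Qed.

Section CyclicQuivers.
Variables (R : realType) (G : quiver) (M : hilbert_rep R G).

Lemma incoming_map (inc : vertex G -> arrow G)
    (inc_target : forall w, target (inc w) = w)
    (inc_uniq : forall a, inc (target a) = a) :
  exists F : forall w,
    bounded_operator (Defs.space M (source (inc w))) (Defs.space M w),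
  forall T : operator_family M, 
    (forall w x, T w (F w x) = F w (T (source (inc w)) x)) ->
    endomorphisms T.
Proof.
pose F w := ecast v (bounded_operator (Defs.space M (source (inc w))) (Defs.space M v))
  (inc_target w) (arrow_map M (inc w)).
exists F => T TF a.
suff edge w b : inc w = b -> forall x : Defs.space M (source b),
  T (target b) (arrow_map M b x) = arrow_map M b (T (source b) x).
  exact: edge (inc_uniq a).
by move=> <- x; apply: (@intertwining_cast _ _ (Defs.space M)) (TF w x).
Qed.

Lemma oriented_cyclic_finite_dimensional :
  oriented_cyclic G -> transitive_rep M -> ~ infinite_dimensional_rep M.
Proof.
move=> [m [m_gt0 [phi [psi [phi_bij psi_bij iso]]]]] [[v0 [x0 x0_neq0]] endE].
have [psi' psiK psi'K] := psi_bij.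
have phi_inj := bij_inj phi_bij.
pose inc w := psi' (ord_pred (phi w)).
have inc_target w : target (inc w) = w.
  by apply: phi_inj; rewrite -(iso _).2 /= psi'K ord_predK.
have inc_uniq a : inc (target a) = a.
  by rewrite /inc -(iso a).2 /= ordSK psiK.
pose pr w := source (inc w).
have phi_iter j w : phi (iter j pr w) = iter j (@ord_pred m) (phi w).
  by elim: j => //= j <-; rewrite -(iso _).1 /= psi'K.
have [F FP] := incoming_map inc_target inc_uniq.
move=> [v]; apply.
apply: (@cyclic_system_finite_dimensional R (vertex G) (Defs.space M) pr
  F m _ _ m_gt0 _ v0 x0 x0_neq0).
- move=> w; apply: phi_inj; rewrite phi_iter.
  by rewrite -[LHS]iter_ordS_period iter_ord_predK.
- move=> w j j0 jm; apply/eqP => /(congr1 phi); rewrite phi_iter => E.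
  have /eqP[] := iter_ordS_aperiodic (phi w) j0 jm.
  by rewrite -{1}E iter_ord_predK.
- move=> T /FP; rewrite endE; exact.
Qed.

End CyclicQuivers.

Lemma eq_set2 (T : finType) (a b c d : T) :
  [set a; b]%SET = [set c; d]%SET -> (a = c /\ b = d) \/ (a = d /\ b = c).
Proof.
move=> E; have /set2P[ac|ad] : a \in [set c; d]%SET by rewrite -E set21.
  have /set2P[bc|bd] : b \in [set c; d]%SET by rewrite -E set22.
    have /set2P[da|db] : d \in [set a; b]%SET by rewrite E set22.
      by left; rewrite bc da ac.
    by left.
  by left.
have /set2P[bc|bd] : b \in [set c; d]%SET by rewrite -E set22.
  by right.
have /set2P[ca|cb] : c \in [set a; b]%SET by rewrite E set21.
  by right; rewrite bd ca ad.
by right.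
Qed.

Section CycleOrientations.
Variables (n : nat) (G : quiver).
Variables (phi : vertex G -> 'I_n.+1) (psi : arrow G -> 'I_n.+1).
Hypotheses (phi_bij : bijective phi) (psi_bij : bijective psi).
Hypothesis ends_iso : forall a : arrow G,
  [set psi a; ordS (psi a)]%SET = (phi @: [set source a; target a])%SET.

Lemma orientation a :
  (phi (source a) = psi a /\ phi (target a) = ordS (psi a)) \/
  (phi (source a) = ordS (psi a) /\ phi (target a) = psi a).
Proof.
have := ends_iso a; rewrite imsetU1 imset_set1 => /eq_set2.
by case=> -[-> ->]; [left | right].
Qed.

(** If edge i points backwards, its source is i+1; the next edge cannot start
there as well, so it points backwards too. Hence all edges point the same way,
and in the backward case the reflection of the cycle is an isomorphism. *)
Lemma source_inj_oriented_cyclic :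
  injective (@source G) -> oriented_cyclic G.
Proof.
move=> src_inj; have [psi' psiK psi'K] := psi_bij.
have [fwd|/existsNP[a0 a0_bwd]] := pselect (forall a, phi (source a) = psi a).
  exists n.+1; split=> //; exists phi, psi; split=> // a; split; first by rewrite fwd.
  by case: (orientation a) => -[E ->] //=; rewrite -E fwd.
have bwd j : phi (source (psi' (iter j (@ordS n.+1) (psi a0))))
    = ordS (iter j (@ordS n.+1) (psi a0)).
  elim: j => [|j IHj].
    by rewrite /= psiK; case: (orientation a0) => -[] // /a0_bwd.
  (* Were edge i + 1 to point forwards, it would share its source with edge i
     and so be equal to it, which happens only for n = 0. *)
  set i := iter j _ _ in IHj *.
  case: (orientation (psi' (ordS i))) => -[]; rewrite psi'K //= -/i => E _.
  rewrite E.
  have : psi' i = psi' (ordS i).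
    by apply: src_inj; apply: (bij_inj phi_bij); rewrite IHj E.
  by move/(congr1 (@ordS n.+1 \o psi)); rewrite /= !psi'K.
have bwdE a : phi (source a) = ordS (psi a).
  have [j _ aE] := iter_ordS_reach (psi a0) (psi a).
  by rewrite aE -bwd -aE psiK.
have rev_bij : bijective (@rev_ord n.+1) by exists (@rev_ord n.+1); exact: rev_ordK.
have ordS_bij : bijective (@ordS n.+1).
  by exists (@ord_pred n.+1); [exact: ordSK | exact: ord_predK].
exists n.+1; split=> //.
exists (fun v => rev_ord (phi v)), (fun a => rev_ord (ordS (psi a))).
split.
- exact: bij_comp rev_bij phi_bij.
- exact: bij_comp rev_bij (bij_comp ordS_bij psi_bij).
- move=> a; rewrite bwdE; split=> //=; rewrite ordS_rev_ordS.
  by case: (orientation a) => -[E ->] //; rewrite -bwdE E.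
Qed.

Lemma two_outgoing_arrows : ~ oriented_cyclic G ->
  exists a b : arrow G, a != b /\ source a = source b.
Proof.
move=> ncyc; apply: contra_notP ncyc => /forallNP no_fork.
apply: source_inj_oriented_cyclic => a b ab.
apply/eqP/negPn/negP => a_neq_b; case: (no_fork a); by exists b.
Qed.

Lemma two_arrows_no_loop (a b c : arrow G) : a != b -> source c != target c.
Proof.
move=> ab; have n_gt0 : (0 < n)%N.
  rewrite lt0n; apply: contra_neq ab => n0; apply: (bij_inj psi_bij).
  by apply: val_inj; move: (ltn_ord (psi a)) (ltn_ord (psi b)); rewrite /=; lia.
apply/eqP => /(congr1 phi); have /eqP := ordS_neq (psi c) n_gt0.
by case: (orientation c) => -[-> ->] neq E; apply: neq.
Qed.

(** Removing one vertex from a cycle leaves a path, which is connected. *)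
Lemma transport_away_from (v0 : vertex G) (X : Type) (f : vertex G -> X) :
  (forall a : arrow G, source a != v0 -> target a != v0 ->
     f (source a) = f (target a)) ->
  forall v w, v != v0 -> w != v0 -> f v = f w.
Proof.
move=> f_edge; have [phi' phiK phi'K] := phi_bij; have [psi' psiK psi'K] := psi_bij.
pose at_ j := phi' (iter j (@ordS n.+1) (phi v0)).
have at_neq j : (0 < j <= n)%N -> at_ j != v0.
  move=> /andP[j0 jn]; rewrite -(inj_eq (bij_inj phi_bij)) phi'K.
  exact: iter_ordS_aperiodic.
have step j : (0 < j)%N -> (j < n)%N -> f (at_ j.+1) = f (at_ j).
  move=> j0 jn; set e := psi' (iter j (@ordS n.+1) (phi v0)).
  have atj : at_ j != v0 by apply: at_neq; rewrite j0 ltnW.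
  have atj1 : at_ j.+1 != v0 by exact: at_neq.
  have pe : phi (at_ j) = psi e by rewrite phi'K psi'K.
  have pe1 : phi (at_ j.+1) = ordS (psi e) by rewrite phi'K psi'K.
  case: (orientation e); rewrite -pe1 -pe => -[/(bij_inj phi_bij) s /(bij_inj phi_bij) t];
    by rewrite -s -t f_edge ?s ?t.
suff from1 v : v != v0 -> f v = f (at_ 1%N).
  by move=> v w /from1 -> /from1 ->.
have [j jn vE] := iter_ordS_reach (phi v0) (phi v).
have -> : v = at_ j by rewrite /at_ -vE phiK.
case: j jn {vE} => [|j] jn; first by rewrite /at_ /= phiK eqxx.
move=> _; elim: j jn => [//|j IHj] jn.
by rewrite step // IHj // ltnW.
Qed.

End CycleOrientations.

(** * Infinite-dimensional transitive representations *)

Lemma scalar_families_endomorphisms (R : realType) (G : quiver)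
    (M : hilbert_rep R G) : @scalar_families R G M `<=` @endomorphisms R G M.
Proof. by move=> T [c Tc] a x; rewrite !Tc linearZ. Qed.

Section ForkRepresentation.
Variables (R : realType) (G : quiver) (a b : arrow G).

Lemma id_linear : linear (fun x : ell2 R => x). Proof. by []. Qed.

Lemma id_bounded : bounded_map (fun x : ell2 R => x).
Proof. by exists 1 => x; rewrite mul1r. Qed.

Definition fork_rep : hilbert_rep R G :=
  @HilbertRep R G (fun=> ell2 R) (fun e =>
    if e == a then @weight R else if e == b then @shift R
    else bounded_linear id_linear id_bounded).

(** The last hypothesis states that the quiver remains connected when the common
source of [a] and [b] is removed; it makes an endomorphism constant there. *)
Lemma fork_rep_transitive : a != b -> source a = source b ->
  target a != source a -> target b != source a ->
  (forall (X : Type) (f : vertex G -> X),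
     (forall e : arrow G, source e != source a -> target e != source a ->
        f (source e) = f (target e)) ->
     forall v w, v != source a -> w != source a -> f v = f w) ->
  transitive_rep fork_rep.
Proof.
move=> ab sab ta tb transport; split.
  exists (source a), (basis R 0); apply/eqP => /(congr1 (fun u : ell2 R => u 0%N)).
  by rewrite basisE => /eqP; rewrite oner_eq0.
apply/seteqP; split; last exact: scalar_families_endomorphisms.
move=> T endT.
pose f v : ell2 R -> ell2 R := T v.
have f_const : forall v w, v != source a -> w != source a -> f v = f w.
  apply: transport => e se te; apply/funext => x.
  have := endT e x; rewrite /= ifN; last by apply: contraNneq se => ->.
  by rewrite ifN //; apply: contraNneq se => ->; rewrite sab.
have [c [T1c T2c]] : exists c : R[i],
    (forall x, f (source a) x = c *: x) /\ (forall x, f (target a) x = c *: x).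
  apply: (@kronecker_scalar R (T (source a)) (T (target a))) => x.
    by have := endT a x; rewrite /= eqxx.
  have := endT b x; rewrite /= eqxx eq_sym (negbTE ab) -/(f _) -/(f (source b) _).
  by rewrite (f_const _ (target a)) // -sab.
exists c => v x; have [->|va] := eqVneq v (source a); first exact: T1c.
by rewrite -[T v x]/(f v x) (f_const v (target a)).
Qed.

End ForkRepresentation.

Theorem theorem4p10 (R : realType) (n : nat) (G : quiver)
    (hG : multigraph_iso (underlying G) (Atilde n)) :
  (exists M : hilbert_rep R G, transitive_rep M /\ infinite_dimensional_rep M)
  <-> ~ oriented_cyclic G.
Proof.
split=> [[M [Mtrans Minf]] cyc|ncyc].
  exact: oriented_cyclic_finite_dimensional cyc Mtrans Minf.
have [phi [psi [phi_bij psi_bij ends_iso]]] := hG.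
have [a [b [ab sab]]] := two_outgoing_arrows phi_bij psi_bij ends_iso ncyc.
have no_loop c := two_arrows_no_loop psi_bij ends_iso c ab.
exists (fork_rep R a b); split; last first.
  by exists (source a); exact: ell2_not_finite_dimensional.
apply: fork_rep_transitive => //.
- by rewrite eq_sym no_loop.
- by rewrite sab eq_sym no_loop.
- by move=> X f; exact: (transport_away_from phi_bij psi_bij ends_iso).
Qed.
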